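(* Let $m,n\ge 1$ and $1\le k\le\min\{m,n\}$ be integers, let $\rho\in (M_m\otimes M_n)^+$ be a mixed quantum state, and let $P$ be the orthogonal projection onto $\mathrm{range}(\rho)$. Then $D_{k\text{-ent}}(\rho)=1$ if and only if $\|P\|_{S(k)}\le 1/2$.
   Context: $(M_m\otimes M_n)^+$ is the set of positive semidefinite matrices in $M_m\otimes M_n$ ($M_n$ being the $n\times n$ complex matrices). A mixed quantum state is a positive semidefinite matrix of trace $1$. The trace norm $\|A\|_{\mathrm{tr}}$ is the sum of the singular values of $A$. $C_{k\text{-ent}}\subseteq (M_m\otimes M_n)^+$ is the set of all finite sums $\sum_j\mathbf{v}_j\mathbf{v}_j^*$ where each $\mathbf{v}_j$ can be written as $\mathbf{v}_j=\sum_{i=1}^k\mathbf{x}_{i,j}\otimes\mathbf{y}_{i,j}$ with $\mathbf{x}_{i,j}\in\mathbb{C}^m$, $\mathbf{y}_{i,j}\in\mathbb{C}^n$. The modified trace distance of $k$-entanglement is $$D_{k\text{-ent}}(\rho)=\min\{\|\rho-X\|_{\mathrm{tr}} : X\in C_{k\text{-ent}}\}.$$ For positive semidefinite $X\in M_m\otimes M_n$, $$\|X\|_{S(k)}=\max\Big\{\mathbf{v}^*X\mathbf{v} : \mathbf{v}\in\mathbb{C}^m\otimes\mathbb{C}^n \text{ is a unit vector of the form } \mathbf{v}=\sum_{i=1}^k\mathbf{x}_i\otimes\mathbf{y}_i,\ \mathbf{x}_i\in\mathbb{C}^m,\ \mathbf{y}_i\in\mathbb{C}^n\Big\}.$$ 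*)

(* Defs.v *)
From HB Require Import structures.
From mathcomp Require Import all_boot all_order all_algebra.
From mathcomp Require Import spectral mxtens complex.
From mathcomp Require Import boolp classical_sets reals.

Set Implicit Arguments.
Unset Strict Implicit.
Unset Printing Implicit Defensive.

Import Order.TTheory GRing.Theory Num.Theory.
Local Open Scope ring_scope.
Local Open Scope classical_set_scope.
Local Open Scope sesquilinear_scope.

(* C is R[i] for R : realType.  M_m (x) M_n is identified with 'M[R[i]]_(m * n), and C^m (x) C^n with
   'cV[R[i]]_(m * n), through the Kronecker product [tensmx] of mxtens. *)

Definition psdmx (R : realType) (N : nat) (A : 'M[R[i]]_N) : Prop :=
  A \is hermsymmx /\ forall v : 'cV[R[i]]_N, 0 <= (v ^t* *m A *m v) 0 0.

(* A ^t* *m A is normal, so its [spectral_diag] is the list of its eigenvalues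
   with multiplicity; they are real and nonnegative, hence [Re] loses nothing. *)
Definition singular_value (R : realType) (N : nat) (A : 'M[R[i]]_N)
    (i : 'I_N) : R :=
  Num.sqrt (complex.Re (spectral_diag (A ^t* *m A) 0 i)).

Definition trace_norm (R : realType) (N : nat) (A : 'M[R[i]]_N) : R :=
  \sum_(i < N) singular_value A i.

(* The tensor product of two columns has 1 * 1 columns, which reduces to 1. *)
Definition schmidt_le (R : realType) (m n k : nat)
    (v : 'cV[R[i]]_(m * n)) : Prop :=
  exists (x : 'I_k -> 'cV[R[i]]_m) (y : 'I_k -> 'cV[R[i]]_n),
    v = \sum_(i < k) (tensmx (x i) (y i) : 'cV[R[i]]_(m * n)).

Definition k_ent_cone (R : realType) (m n k : nat) : set 'M[R[i]]_(m * n) :=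
  [set X | exists (J : nat) (v : 'I_J -> 'cV[R[i]]_(m * n)),
     (forall j, schmidt_le k (v j)) /\ X = \sum_(j < J) v j *m (v j) ^t*].

(* The cone is closed and contains 0, so the infimum is attained: it is the
   minimum of the distances. *)
Definition D_k_ent (R : realType) (m n k : nat) (rho : 'M[R[i]]_(m * n)) : R :=
  inf [set trace_norm (rho - X) | X in @k_ent_cone R m n k].

(* For 1 <= k and 1 <= m, n the unit vectors in question form a nonempty compact
   set, so the supremum is attained: it is the maximum.  The quadratic form is
   real for positive semidefinite X, hence [Re] loses nothing. *)
Definition S_norm (R : realType) (m n k : nat) (X : 'M[R[i]]_(m * n)) : R :=
  sup [set complex.Re ((v ^t* *m X *m v) 0 0) | v in
        [set v : 'cV[R[i]]_(m * n) |
           (v ^t* *m v) 0 0 = 1 /\ schmidt_le k v]].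

(* [submx] compares row spaces; transposing makes it compare column spaces. *)
Definition orthogonal_projection_onto_range (R : realType) (N : nat)
    (P A : 'M[R[i]]_N) : Prop :=
  [/\ P \is hermsymmx, P *m P = P & (P^T == A^T)%MS].

(* Main.v *)
(* For a Hermitian A the trace norm is the sum of the |<e_i, A e_i>| over an
   eigenbasis, so it is at least |tr (J A)| for every contraction J, and at most
   tr B + tr C whenever A = B - C with B, C >= 0.

   If ||P||_S(k) <= 1/2, take J = 2 P - 1: then tr (J rho) = 1, while
   tr (J X) <= 0 for every X in the cone, so ||rho - X||_tr >= 1, with equality
   at X = 0.

   Conversely let v be a unit vector of Schmidt rank at most k with
   v^* P v = 1/2 + s, s > 0, and q = (1 - P) v.  For small eps > 0 one has
   rho - eps v v^* = B - C with C = eps (1 + s) q q^* and B >= 0, so that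
   ||rho - eps v v^*||_tr <= 1 - eps + 2 eps (1 + s) (1/2 - s)
                           = 1 - eps (s + 2 s^2) < 1. *)

Require Import Defs.
From mathcomp Require Import all_boot all_order all_algebra.
From mathcomp Require Import spectral mxtens complex.
From mathcomp Require Import boolp classical_sets reals.
From mathcomp Require Import ring.

Import Order.TTheory GRing.Theory Num.Theory.
Local Open Scope ring_scope.
Local Open Scope sesquilinear_scope.

(** * Conjugate transpose, Hermitian matrices and quadratic forms *)

Lemma adjmxM (C : numClosedFieldType) (p q r : nat)
    (A : 'M[C]_(p, q)) (B : 'M[C]_(q, r)) :
  (A *m B)^t* = B^t* *m A^t*.
Proof. by rewrite trmx_mul map_mxM. Qed.

Lemma adjmxD (C : numClosedFieldType) (p q : nat) (A B : 'M[C]_(p, q)) :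
  (A + B)^t* = A^t* + B^t*.
Proof. by rewrite linearD map_mxD. Qed.

Lemma adjmxN (C : numClosedFieldType) (p q : nat) (A : 'M[C]_(p, q)) :
  (- A)^t* = - A^t*.
Proof. by rewrite linearN map_mxN. Qed.

Lemma adjmxB (C : numClosedFieldType) (p q : nat) (A B : 'M[C]_(p, q)) :
  (A - B)^t* = A^t* - B^t*.
Proof. by rewrite adjmxD adjmxN. Qed.

Lemma adjmxZ (C : numClosedFieldType) (p q : nat) (a : C) (A : 'M[C]_(p, q)) :
  (a *: A)^t* = a^* *: A^t*.
Proof. by rewrite linearZ map_mxZ. Qed.

Lemma adjmx1 (C : numClosedFieldType) (n : nat) :
  (1%:M : 'M[C]_n)^t* = 1%:M.
Proof. by rewrite trmx1 map_mx1. Qed.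

Lemma hermsymmxE (C : numClosedFieldType) (n : nat) (A : 'M[C]_n) :
  (A \is hermsymmx) = (A^t* == A).
Proof. by rewrite is_hermitianmxE expr0 scale1r eq_sym. Qed.

Lemma hermsymmxP (C : numClosedFieldType) (n : nat) (A : 'M[C]_n) :
  reflect (A^t* = A) (A \is hermsymmx).
Proof. by rewrite hermsymmxE; apply: eqP. Qed.

Lemma dotmx_ge0 (C : numClosedFieldType) (n : nat) (v : 'cV[C]_n) :
  0 <= (v^t* *m v) 0 0.
Proof.
by rewrite mxE sumr_ge0 // => i _; rewrite !mxE mulrC mul_conjC_ge0.
Qed.

Lemma trace_outer (C : numClosedFieldType) (n : nat) (A : 'M[C]_n)
    (v : 'cV[C]_n) : \tr (A *m (v *m v^t*)) = (v^t* *m A *m v) 0 0.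
Proof. by rewrite mulmxA mxtrace_mulC mulmxA /mxtrace big_ord1. Qed.

(** * Eigenvalues and the trace norm of Hermitian matrices *)

Lemma char_poly_similar (F : fieldType) (n : nat) (Q A : 'M[F]_n) :
  Q \in unitmx -> char_poly (invmx Q *m A *m Q) = char_poly A.
Proof.
move=> Qu; rewrite /char_poly /char_poly_mx.
have QX : invmx (map_mx polyC Q) = map_mx polyC (invmx Q).
  by rewrite map_invmx.
have QXu : map_mx polyC Q \in unitmx.
  by rewrite unitmxE det_map_mx rmorph_unit // -unitmxE.
have -> : 'X%:M - map_mx polyC (invmx Q *m A *m Q) =
    invmx (map_mx polyC Q) *m ('X%:M - map_mx polyC A) *m map_mx polyC Q.
  rewrite !map_mxM -QX mulmxBr mulmxBl scalar_mxC -(mulmxA 'X%:M) mulVmx //.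
  by rewrite mulmx1.
rewrite !det_mulmx mulrAC -det_mulmx mulVmx // det1 mul1r //.
Qed.

Lemma char_poly_diag (F : fieldType) (n : nat) (d : 'rV[F]_n) :
  char_poly (diag_mx d) = \prod_(i < n) ('X - (d 0 i)%:P).
Proof.
rewrite char_poly_trig ?diag_mx_is_trig //.
by apply: eq_bigr => i _; rewrite mxE eqxx.
Qed.

Lemma spectralE (C : numClosedFieldType) (n : nat) (A : 'M[C]_n)
    (U := spectralmx A) : A \is normalmx ->
  A = U^t* *m diag_mx (spectral_diag A) *m U.
Proof.
move=> /orthomx_spectralP {1}->.
by rewrite invmx_unitary // spectral_unitarymx.
Qed.

Lemma spectralmxK (C : numClosedFieldType) (n : nat) (A : 'M[C]_n)
    (U := spectralmx A) : U *m U^t* = 1%:M.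
Proof. exact/unitarymxP/spectral_unitarymx. Qed.

Lemma spectralmxVK (C : numClosedFieldType) (n : nat) (A : 'M[C]_n)
    (U := spectralmx A) : U^t* *m U = 1%:M.
Proof. by apply: mulmx1C; rewrite spectralmxK. Qed.

(** As [A] is Hermitian, [A^* A = A^2] is similar to the diagonal matrix of squared eigenvalues.
    Equal characteristic polynomials have the same roots with multiplicity, but in no prescribed
    order, hence a permutation. *)
Lemma perm_spectral_diag_sqr (C : numClosedFieldType) (n : nat) (A : 'M[C]_n) :
  A \is hermsymmx ->
  perm_eq [seq spectral_diag (A^t* *m A) 0 i | i : 'I_n]
          [seq spectral_diag A 0 i ^+ 2 | i : 'I_n].
Proof.
move=> Ah; have An := hermitian_normalmx Ah.
have Aadj := hermsymmxP _ _ _ Ah.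
have AAn : A^t* *m A \is normalmx.
  by apply: hermitian_normalmx; apply/hermsymmxP; rewrite adjmxM trmxCK.
apply: prod_XsubC_eq; rewrite !big_image /=.
rewrite -char_poly_diag -(char_poly_similar _ _ _ _ (spectral_unit (A^t* *m A))).
rewrite -(orthomx_spectralP AAn) Aadj.
have -> : A *m A = invmx (spectralmx A) *m
    diag_mx (\row_i spectral_diag A 0 i ^+ 2) *m spectralmx A.
  rewrite {1 2}(orthomx_spectralP An) !mulmxA mulmxK ?spectral_unit //.
  by rewrite -(mulmxA (invmx _) (diag_mx _) (diag_mx _)) mulmx_diag.
rewrite char_poly_similar ?spectral_unit // char_poly_diag.
by apply: eq_bigr => i _; rewrite mxE.
Qed.

(** The sum only sees the multiset of eigenvalues of [A^* A], and the square root of the square of a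
    real eigenvalue is its absolute value. *)
Lemma trace_norm_hermitian (R : realType) (n : nat) (A : 'M[R[i]]_n) :
  A \is hermsymmx ->
  ((trace_norm A)%:C)%C = \sum_(i < n) `|spectral_diag A 0 i|.
Proof.
move=> Ah; rewrite /trace_norm /singular_value.
pose f (z : R[i]) := Num.sqrt (complex.Re z).
have -> : \sum_(i < n) Num.sqrt (complex.Re (spectral_diag (A^t* *m A) 0 i)) =
    \sum_(z <- [seq spectral_diag (A^t* *m A) 0 i | i : 'I_n]) f z.
  by rewrite big_image.
rewrite (perm_big _ (perm_spectral_diag_sqr _ _ _ Ah)) big_image /=.
rewrite rmorph_sum; apply: eq_bigr => i _.
have /mxOverP/(_ 0 i)/complex_realP[x ->] := hermitian_spectral_diag_real Ah.
rewrite /f -rmorphXn /= sqrtr_sqr normc_def /= expr0n addr0 sqrtr_sqr.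
by [].
Qed.

(** Row [i] of [U] is the adjoint of [e]; this turns diagonal entries in an eigenbasis into
    quadratic forms. *)
Lemma conj_diag_entry (C : numClosedFieldType) (n : nat) (U B : 'M[C]_n)
    (i : 'I_n) (e := col i (U^t*)) :
  (U *m B *m U^t*) i i = (e^t* *m B *m e) 0 0.
Proof.
have -> : e^t* = row i U by rewrite -[U in RHS]trmxCK tr_col map_row.
by rewrite -row_mul !mxE; apply: eq_bigr => j _; rewrite !mxE.
Qed.

Lemma spectral_diagE (C : numClosedFieldType) (n : nat) (A : 'M[C]_n)
    (i : 'I_n) (e := col i ((spectralmx A)^t*)) :
  A \is hermsymmx -> spectral_diag A 0 i = (e^t* *m A *m e) 0 0.
Proof.
move=> Ah; have An := hermitian_normalmx Ah.
rewrite /e -conj_diag_entry {3}(spectralE _ _ _ An) !mulmxA spectralmxK mul1mx.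
by rewrite -mulmxA spectralmxK mulmx1 mxE eqxx.
Qed.

Lemma trace_spectral (C : numClosedFieldType) (n : nat) (A B : 'M[C]_n)
    (e := fun i => col i ((spectralmx A)^t*)) :
  \tr B = \sum_(i < n) ((e i)^t* *m B *m e i) 0 0.
Proof.
under eq_bigr do rewrite -conj_diag_entry.
by rewrite -/(mxtrace _) mxtrace_mulC mulmxA spectralmxVK mul1mx.
Qed.

(** Each eigenvalue of [B - C] is [e^* B e - e^* C e] for a unit eigenvector [e], so its modulus is
    at most [e^* B e + e^* C e]; summing over the eigenbasis gives the traces. *)
Lemma trace_norm_le_psd (R : realType) (n : nat) (B C : 'M[R[i]]_n) :
  psdmx B -> psdmx C -> ((trace_norm (B - C))%:C)%C <= \tr B + \tr C.
Proof.
move=> [Bh Bp] [Ch Cp].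
have Ah : B - C \is hermsymmx.
  by apply/hermsymmxP; rewrite adjmxB (hermsymmxP _ _ _ Bh) (hermsymmxP _ _ _ Ch).
rewrite trace_norm_hermitian // !(trace_spectral _ _ (B - C)) -big_split /=.
apply: ler_sum => i _; rewrite spectral_diagE //.
set e := col i _; rewrite mulmxBr mulmxBl [X in `|X|]mxE [X in _ + X]mxE.
by rewrite (le_trans (ler_normB _ _)) // !ger0_norm.
Qed.

(** In an orthonormal eigenbasis [e_i] of [A], [tr (J A)] is the sum of the eigenvalues weighted by
    [e_i^* J e_i], and these weights have modulus at most 1. *)
Lemma trace_norm_ge_contraction (R : realType) (n : nat) (J A : 'M[R[i]]_n) :
  A \is hermsymmx ->
  (forall v : 'cV_n, `|(v^t* *m J *m v) 0 0| <= (v^t* *m v) 0 0) ->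
  `|\tr (J *m A)| <= ((trace_norm A)%:C)%C.
Proof.
move=> Ah Jc; have An := hermitian_normalmx Ah.
rewrite trace_norm_hermitian // {1}(spectralE _ _ _ An).
rewrite !mulmxA mxtrace_mulC !mulmxA /mxtrace.
apply: (le_trans (ler_norm_sum _ _ _)); apply: ler_sum => i _.
rewrite mul_mx_diag mxE conj_diag_entry normrM.
rewrite ler_piMl //; apply: (le_trans (Jc _)).
set e := col i _; have -> : (e^t* *m e) 0 0 = (e^t* *m 1%:M *m e) 0 0.
  by rewrite mulmx1.
by rewrite -conj_diag_entry mulmx1 spectralmxK mxE eqxx.
Qed.

(** * Positive semidefinite matrices *)

Lemma psdmxD (R : realType) (n : nat) (A B : 'M[R[i]]_n) :
  psdmx A -> psdmx B -> psdmx (A + B).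
Proof.
move=> [Ah Ap] [Bh Bp]; split.
  by apply/hermsymmxP; rewrite adjmxD (hermsymmxP _ _ _ Ah) (hermsymmxP _ _ _ Bh).
by move=> v; rewrite mulmxDr mulmxDl mxE addr_ge0.
Qed.

Lemma psdmxZ (R : realType) (n : nat) (a : R[i]) (A : 'M[R[i]]_n) :
  0 <= a -> psdmx A -> psdmx (a *: A).
Proof.
move=> a0 [Ah Ap]; split.
  apply/hermsymmxP; rewrite adjmxZ (hermsymmxP _ _ _ Ah).
  by rewrite (CrealP _) // ger0_real.
by move=> v; rewrite -scalemxAr -scalemxAl mxE mulr_ge0.
Qed.

Lemma psdmx_conj (R : realType) (p q : nat) (A : 'M[R[i]]_p) (M : 'M_(p, q)) :
  psdmx A -> psdmx (M^t* *m A *m M).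
Proof.
move=> [Ah Ap]; split.
  by apply/hermsymmxP; rewrite !adjmxM trmxCK (hermsymmxP _ _ _ Ah) mulmxA.
by move=> v; have := Ap (M *m v); rewrite adjmxM !mulmxA.
Qed.

Lemma psdmx1 (R : realType) (n : nat) : psdmx (1%:M : 'M[R[i]]_n).
Proof.
split; first by apply/hermsymmxP; rewrite adjmx1.
by move=> v; rewrite mulmx1 dotmx_ge0.
Qed.

Lemma psdmx_outer (R : realType) (n : nat) (v : 'cV[R[i]]_n) :
  psdmx (v *m v^t*).
Proof.
by have := psdmx_conj _ _ _ _ (v^t*) (psdmx1 R 1); rewrite trmxCK mulmx1.
Qed.

Lemma psdmx0 (R : realType) (n : nat) : psdmx (0 : 'M[R[i]]_n).
Proof. by have := psdmxZ _ _ _ _ (lexx 0) (psdmx1 R n); rewrite scale0r. Qed.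

Lemma psdmx_sum (R : realType) (n J : nat) (F : 'I_J -> 'M[R[i]]_n) :
  (forall j, psdmx (F j)) -> psdmx (\sum_j F j).
Proof.
move=> Fp; apply: (big_ind (@psdmx R n)) => //; [exact: psdmx0 | exact: psdmxD].
Qed.

(** With [Z = A u u^* A] and [M = 1 - c u u^* A], one has [A - c Z = M^* A M + c^2 Z], a sum of two
    positive semidefinite terms. The summand 1 in the denominator keeps [c] positive even when
    [u^* A u = 0]. *)
Lemma psdmx_sub_outer (R : realType) (n : nat) (A : 'M[R[i]]_n)
    (u : 'cV[R[i]]_n) (c := (1 + (u^t* *m A *m u) 0 0)^-1) :
  psdmx A -> psdmx (A - c *: ((A *m u) *m (A *m u)^t*)).
Proof.
move=> Apsd; have [Ah Ap] := Apsd; have Aadj := hermsymmxP _ _ _ Ah.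
pose h := (u^t* *m A *m u) 0 0.
have c0 : 0 <= c by rewrite invr_ge0 addr_ge0.
have ch : c * (1 + h) = 1 by rewrite mulVf // gt_eqF // ltr_pwDl.
have cr : c^* = c by rewrite (CrealP _) // ger0_real.
pose M := 1%:M - c *: (u *m u^t* *m A).
suff -> : A - c *: ((A *m u) *m (A *m u)^t*) =
    M^t* *m A *m M + c ^+ 2 *: ((A *m u) *m (A *m u)^t*).
  apply: psdmxD; first exact: psdmx_conj.
  by apply: psdmxZ; [exact: exprn_ge0 | exact: psdmx_outer].
rewrite /M adjmxB adjmx1 adjmxZ !adjmxM trmxCK Aadj cr.
rewrite mulmxBl mul1mx mulmxBr mulmxBl !mulmx1 -!scalemxAl -!scalemxAr !mulmxA.
set Z := A *m u *m u^t* *m A.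
(* The inner factor [u^* A u] is a 1 by 1 matrix, hence the scalar [h]. *)
have ZuA : Z *m u *m u^t* *m A = h *: Z.
  rewrite /Z -(mulmxA (A *m u)) -(mulmxA (A *m u)).
  have -> : u^t* *m A *m u = h%:M by exact: mx11_scalar.
  by rewrite mul_mx_scalar -!scalemxAl !mulmxA.
have -> : c ^+ 2 = c - c * (c * h).
  by have -> : c * h = 1 - c; [rewrite -ch | idtac]; ring.
by rewrite !mulmxBl -!scalemxAl ZuA scalerBr !scalerA -mulrA -/Z scalerBl subrK.
Qed.

(** * Schmidt rank and orthogonal projections *)

Lemma schmidt_leZ (R : realType) (m n k : nat) (a : R[i])
    (v : 'cV[R[i]]_(m * n)) : schmidt_le k v -> schmidt_le k (a *: v).
Proof.
move=> [x [y ->]]; exists (fun i => a *: x i), y.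
rewrite scaler_sumr; apply: eq_bigr => i _.
by apply/matrixP=> p q; rewrite !mxE mulrA.
Qed.

Lemma projection_form (C : numClosedFieldType) (N : nat) (P : 'M[C]_N)
    (v : 'cV[C]_N) : P \is hermsymmx -> P *m P = P ->
  (v^t* *m P *m v) 0 0 = ((P *m v)^t* *m (P *m v)) 0 0.
Proof.
by move=> /hermsymmxP Pa PP; rewrite adjmxM Pa mulmxA -(mulmxA _ P P) PP.
Qed.

Lemma projection_complement_form (C : numClosedFieldType) (N : nat)
    (P : 'M[C]_N) (v : 'cV[C]_N) : P \is hermsymmx -> P *m P = P ->
  ((v - P *m v)^t* *m (v - P *m v)) 0 0 =
  (v^t* *m v) 0 0 - (v^t* *m P *m v) 0 0.
Proof.
move=> /hermsymmxP Pa PP; rewrite adjmxB adjmxM Pa mulmxBl !mulmxBr !mulmxA.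
by rewrite -(mulmxA _ P P) PP subrr subr0 !mxE.
Qed.

Lemma projection_form_ge0 (C : numClosedFieldType) (N : nat) (P : 'M[C]_N)
    (v : 'cV[C]_N) : P \is hermsymmx -> P *m P = P ->
  0 <= (v^t* *m P *m v) 0 0.
Proof. by move=> Ph PP; rewrite projection_form // dotmx_ge0. Qed.

Lemma projection_form_le (C : numClosedFieldType) (N : nat) (P : 'M[C]_N)
    (v : 'cV[C]_N) : P \is hermsymmx -> P *m P = P ->
  (v^t* *m P *m v) 0 0 <= (v^t* *m v) 0 0.
Proof.
by move=> Ph PP; rewrite -subr_ge0 -projection_complement_form // dotmx_ge0.
Qed.

Lemma reflection_form (C : numClosedFieldType) (N : nat) (P : 'M[C]_N)
    (v : 'cV[C]_N) :
  (v^t* *m (2 *: P - 1%:M) *m v) 0 0 =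
  2 * (v^t* *m P *m v) 0 0 - (v^t* *m v) 0 0.
Proof.
by rewrite mulmxBr mulmxBl mulmx1 -scalemxAr -scalemxAl !mxE.
Qed.

(** Since [0 <= v^* P v <= v^* v], the number [2 v^* P v - v^* v] lies between [- v^* v] and
    [v^* v]. *)
Lemma reflection_contraction (R : realType) (N : nat) (P : 'M[R[i]]_N)
    (v : 'cV[R[i]]_N) : P \is hermsymmx -> P *m P = P ->
  `|(v^t* *m (2 *: P - 1%:M) *m v) 0 0| <= (v^t* *m v) 0 0.
Proof.
move=> Ph PP; have := projection_form_ge0 _ _ _ v Ph PP.
have := projection_form_le _ _ _ v Ph PP; have := dotmx_ge0 _ _ v.
rewrite reflection_form; set a := (_ *m P *m _) 0 0; set b := (_ *m v) 0 0.
move=> b0 ab a0; rewrite real_ler_norml; last first.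
  by rewrite rpredB ?rpredM ?ger0_real ?ler0n.
apply/andP; split; first by rewrite lerDr mulr_ge0.
by rewrite lerBlDr -mulr2n -(mulr_natl b) ler_wpM2l.
Qed.

(** The columns of [A] lie in the range of [P], on which [P] acts as the identity. *)
Lemma orthogonal_projection_mulmx (R : realType) (N : nat)
    (P A : 'M[R[i]]_N) : orthogonal_projection_onto_range P A -> P *m A = A.
Proof.
case=> _ PP /andP[_ /submxP[D AD]].
have -> : A = P *m D^T by rewrite -[A]trmxK AD trmx_mul trmxK.
by rewrite mulmxA PP.
Qed.

(** * Lower bound on the distance to the cone *)

Lemma trace_norm_sub_ge1 (R : realType) (m n k : nat)
    (rho P X : 'M[R[i]]_(m * n)) :
  psdmx rho -> \tr rho = 1 -> orthogonal_projection_onto_range P rho ->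
  (forall v : 'cV_(m * n), schmidt_le k v ->
     2 * (v^t* *m P *m v) 0 0 <= (v^t* *m v) 0 0) ->
  k_ent_cone k X -> 1 <= trace_norm (rho - X).
Proof.
move=> [rho_h _] rho_tr hP Pk [J [v [vk ->]]].
have [Ph PP _] := hP.
set X' := \sum_j _.
have [Xh _] : psdmx X' by apply: psdmx_sum => j; exact: psdmx_outer.
have Ah : rho - X' \is hermsymmx.
  by apply/hermsymmxP; rewrite adjmxB (hermsymmxP _ _ _ rho_h) (hermsymmxP _ _ _ Xh).
have := trace_norm_ge_contraction _ _ (2 *: P - 1%:M) _ Ah
  (fun v => reflection_contraction _ _ _ v Ph PP).
rewrite -lecR; apply: le_trans.
have -> : \tr ((2 *: P - 1%:M) *m (rho - X')) =
    1 - \sum_j \tr ((2 *: P - 1%:M) *m (v j *m (v j)^t*)).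
  rewrite mulmxBr linearB; congr (_ - _); last by rewrite mulmx_sumr linear_sum.
  rewrite mulmxBl mul1mx -scalemxAl (orthogonal_projection_mulmx _ _ _ _ hP).
  by rewrite scaler_nat mulr2n addrK.
(* Each summand is [2 v_j^* P v_j - v_j^* v_j], which is nonpositive for vectors of Schmidt rank at
   most [k]. *)
suff le0 : \sum_j \tr ((2 *: P - 1%:M) *m (v j *m (v j)^t*)) <= 0.
  have ge1 : 1 <= 1 - \sum_j \tr ((2 *: P - 1%:M) *m (v j *m (v j)^t*)).
    by rewrite lerDl oppr_ge0.
  by rewrite ger0_norm //; exact: le_trans ler01 ge1.
apply: sumr_le0 => j _; rewrite trace_outer reflection_form subr_le0.
exact: Pk.
Qed.

(** * Upper bounds on the distance to the cone *)

Lemma trace_norm_psd_le (R : realType) (N : nat) (A : 'M[R[i]]_N) :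
  psdmx A -> ((trace_norm A)%:C)%C <= \tr A.
Proof.
move=> Ap; have := trace_norm_le_psd _ _ _ _ Ap (psdmx0 R N).
by rewrite subr0 linear0 addr0.
Qed.

(* With p = A u, one has (1 + 1/s) p p^* + (1 + s) q q^* - (p + q)(p + q)^* =
   (1/s) (p - s q)(p - s q)^*, and A dominates a positive multiple of p p^*. *)
Lemma psdmx_rank1_perturbation (R : realType) (N : nat)
    (A : 'M[R[i]]_N) (u q : 'cV[R[i]]_N) (s : R[i]) :
  psdmx A -> 0 < s ->
  exists2 eps : R[i], 0 < eps &
    psdmx (A - eps *: ((A *m u + q) *m (A *m u + q)^t*)
             + (eps * (1 + s)) *: (q *m q^t*)).
Proof.
move=> Apsd s0; have [_ Ap] := Apsd.
set p := A *m u; pose c := (1 + (u^t* *m A *m u) 0 0)^-1.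
have c0 : 0 < c by rewrite invr_gt0 ltr_pwDl.
have s10 : 0 < 1 + s by rewrite addr_gt0.
(* This makes [eps (1 + 1/s) = c], so the [p p^*] terms add up to the multiple [c p p^*] that [A]
   dominates. *)
pose eps := c * s / (1 + s).
have eps0 : 0 < eps by rewrite divr_gt0 ?mulr_gt0.
exists eps => //; pose z := p - s *: q.
have sr : s^* = s by rewrite (CrealP _) // gtr0_real.
suff -> : A - eps *: ((p + q) *m (p + q)^t*) + (eps * (1 + s)) *: (q *m q^t*) =
    (A - c *: (p *m p^t*)) + (eps / s) *: (z *m z^t*).
  apply: psdmxD; first exact: psdmx_sub_outer.
  by apply: psdmxZ; [exact/ltW/divr_gt0 | exact: psdmx_outer].
rewrite /z adjmxD adjmxB adjmxZ sr !mulmxDl !mulmxDr !mulmxN !mulNmx.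
rewrite -!scalemxAl -!scalemxAr /eps.
(* The products [p p^*], [p q^*], [q p^*], [q q^*] become free matrices, leaving an entrywise
   rational identity. *)
move: (p *m _) (p *m _) (q *m _) (q *m _) => X1 X2 X3 X4.
apply/matrixP=> i j; rewrite !mxE; field.
by rewrite !gt_eqF.
Qed.

Lemma trace_dyad (C : numClosedFieldType) (N : nat) (v : 'cV[C]_N) :
  \tr (v *m v^t*) = (v^t* *m v) 0 0.
Proof. by rewrite mxtrace_mulC /mxtrace big_ord1. Qed.

Lemma k_ent_cone_dyad (R : realType) (m n k : nat) (e : R[i])
    (v : 'cV[R[i]]_(m * n)) :
  0 <= e -> schmidt_le k v -> k_ent_cone k (e *: (v *m v^t*)).
Proof.
move=> e0 vk; exists 1%N, (fun=> sqrtC e *: v); split=> [_|].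
  exact: schmidt_leZ.
have rr : (sqrtC e)^* = sqrtC e by rewrite (CrealP _) // ger0_real ?sqrtC_ge0.
by rewrite big_ord1 adjmxZ rr -scalemxAl -scalemxAr scalerA -expr2 sqrtCK.
Qed.

(** As [P v] lies in the range of [rho], one can write [v = rho u + q] with [u = D^T v] and
    [q = v - P v], the shape required by the rank-one perturbation. *)
Lemma k_ent_cone_closer (R : realType) (m n k : nat)
    (rho P : 'M[R[i]]_(m * n)) (v : 'cV[R[i]]_(m * n)) :
  psdmx rho -> \tr rho = 1 -> orthogonal_projection_onto_range P rho ->
  (v^t* *m v) 0 0 = 1 -> schmidt_le k v -> 1 / 2 < (v^t* *m P *m v) 0 0 ->
  exists2 X, k_ent_cone k X & trace_norm (rho - X) < 1.
Proof.
move=> rho_psd rho_tr [Ph PP /andP[/submxP[D PD] _]] v1 vk.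
set a := (v^t* *m P *m v) 0 0 => a_gt.
have PrhoD : P = rho *m D^T by rewrite -[P]trmxK PD trmx_mul trmxK.
pose q := v - P *m v; pose s := a - 1 / 2.
have s0 : 0 < s by rewrite subr_gt0.
have qq : (q^t* *m q) 0 0 = 1 - a by rewrite projection_complement_form // v1.
have vE : rho *m (D^T *m v) + q = v by rewrite mulmxA -PrhoD addrC subrK.
have [e e0 Bpsd] := psdmx_rank1_perturbation _ _ _ (D^T *m v) q _ rho_psd s0.
rewrite vE in Bpsd.
have Cpsd : psdmx ((e * (1 + s)) *: (q *m q^t*)).
  apply: psdmxZ; last exact: psdmx_outer.
  by apply: mulr_ge0; [exact: ltW | rewrite addr_ge0 // ltW].
exists (e *: (v *m v^t*)); first exact: k_ent_cone_dyad (ltW e0) vk.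
have := trace_norm_le_psd _ _ _ _ Bpsd Cpsd; rewrite addrK -ltcR => /le_lt_trans.
apply; rewrite -scaleNr !mxtraceD !mxtraceZ !trace_dyad rho_tr v1 qq.
(* The trace of the [q q^*] term counts twice, once in each positive semidefinite part; then
   [a = 1/2 + s] is substituted. *)
suff -> : 1 + - e * 1 + e * (1 + s) * (1 - a) + e * (1 + s) * (1 - a) =
    1 - e * (s + 2 * s ^+ 2).
  by rewrite ltrBlDr ltrDl mulr_gt0 // addr_gt0 // mulr_gt0 // exprn_gt0.
by rewrite /s; field.
Qed.

(** * From single vectors and cone elements to the supremum and the infimum *)

Theorem theorem11 (R : realType) (m n k : nat)
    (hm : (1 <= m)%N) (hn : (1 <= n)%N)
    (hk1 : (1 <= k)%N) (hk : (k <= minn m n)%N)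
    (rho P : 'M[R[i]]_(m * n))
    (rho_psd : psdmx rho) (rho_tr : \tr rho = 1)
    (hP : orthogonal_projection_onto_range P rho) :
  D_k_ent k rho = 1 <-> S_norm k P <= 1 / 2.
Proof.
have [Ph PP _] := hP.
have half : (1 / 2 : R[i]) = ((1 / 2 : R)%:C)%C by rewrite !mul1r fmorphV rmorph_nat.
have form_Re (v : 'cV[R[i]]_(m * n)) :
    ((complex.Re ((v^t* *m P *m v) 0 0))%:C)%C = (v^t* *m P *m v) 0 0.
  by rewrite RRe_real // ger0_real // projection_form_ge0.
have norm_ge0 (X : 'M[R[i]]_(m * n)) : 0 <= trace_norm X.
  by apply: sumr_ge0 => i _; exact: sqrtr_ge0.
split=> [D1 | S_le].
  rewrite leNgt; apply/negP => S_gt.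
  have [|_ [v [v1 vk] <-] v_gt] := sup_gt _ S_gt.
    (* An empty set would have supremum 0 by convention, which does not exceed 1/2. *)
    apply/set0P/eqP=> S0; move: S_gt; rewrite /S_norm S0 sup0.
    by rewrite ltNge divr_ge0.
  have [|X Xk X_lt] := k_ent_cone_closer _ _ _ _ _ _ v rho_psd rho_tr hP v1 vk.
    by rewrite -form_Re half ltcR.
  have : D_k_ent k rho <= trace_norm (rho - X).
    apply: ge_inf; last by exists X.
    by exists 0 => _ [Y _ <-].
  by rewrite D1 leNgt X_lt.
have P_le (v : 'cV[R[i]]_(m * n)) : schmidt_le k v ->
    2 * (v^t* *m P *m v) 0 0 <= (v^t* *m v) 0 0.
  move=> vk.
  set b := (v^t* *m v) 0 0.
  have b_ge0 : 0 <= b by exact: dotmx_ge0.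
  (* A vector of norm zero cannot be normalized, but then [v^* P v <= v^* v = 0]. *)
  have [b0 | b_neq0] := eqVneq b 0.
    have /(_ Ph PP) := projection_form_le _ _ P v; rewrite -/b b0 => le0.
    by rewrite pmulr_rle0.
  (* [b] is the squared norm of [v], so [t v] is a unit vector. *)
  pose t := (sqrtC b)^-1.
  have tt : t^* * t = b^-1.
    have tr : t^* = t by rewrite (CrealP _) // ger0_real ?invr_ge0 ?sqrtC_ge0.
    by rewrite tr /t -expr2 exprVn sqrtCK.
  have tform (Q : 'M[R[i]]_(m * n)) : ((t *: v)^t* *m Q *m (t *: v)) 0 0 =
      b^-1 * (v^t* *m Q *m v) 0 0.
    by rewrite adjmxZ -!scalemxAl -scalemxAr scalerA tt mxE.
  have : complex.Re (((t *: v)^t* *m P *m (t *: v)) 0 0) <= 1 / 2.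
    apply: le_trans S_le; apply: ub_le_sup.
      (* The supremum is taken over a bounded set: [w^* P w <= w^* w = 1]. *)
      exists 1 => _ [w [w1 _] <-].
      by rewrite -lecR form_Re (le_trans (projection_form_le _ _ _ _ Ph PP)) // w1.
    exists (t *: v) => //; split; last exact: schmidt_leZ.
    by have := tform 1%:M; rewrite !mulmx1 => ->; rewrite mulVf.
  rewrite -lecR form_Re -half tform ler_pdivlMr // -mulrA mulrC.
  by rewrite ler_pdivrMr ?mul1r 1?mulrC // lt_def b_neq0.
have Z0 : @k_ent_cone R m n k 0.
  by exists 0%N, (fun=> 0); split=> [[]|] //; rewrite big_ord0.
(* Every cone element is at distance at least 1, and [X = 0] is at distance at most [tr rho = 1]. *)
apply/eqP; rewrite eq_le; apply/andP; split; last first.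
  apply: lb_le_inf; first by exists (trace_norm (rho - 0)), 0.
  by move=> _ [X Xk <-]; exact: trace_norm_sub_ge1 rho_psd rho_tr hP P_le Xk.
apply: le_trans (_ : trace_norm (rho - 0) <= 1).
  by apply: ge_inf; [exists 0 => _ [Y _ <-] | exists 0].
by have := trace_norm_psd_le _ _ _ rho_psd; rewrite subr0 rho_tr -lecR.
Qed.
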